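(* For every prime power $q$, $$A_q(12,4;4)\ge q^{24} + q^{20} + q^{19} + 3q^{18} + 2q^{17} + 3q^{16} + q^{15} + q^{14} + 2q^{12} + q^{11} + 3q^{10} + 2q^{9} + 4q^8 + 2q^7 + 4q^6 + 2q^5 + 3q^4 + q^3 + q^2 + 1.$$
   Context: For a prime power $q$, the subspace distance between subspaces $U,U'$ of $\mathbb{F}_q^n$ is $d(U,U')=\dim(U+U')-\dim(U\cap U')$. $A_q(n,d;k)$ denotes the maximum cardinality of a set of $k$-dimensional subspaces of $\mathbb{F}_q^n$ any two distinct elements of which have subspace distance at least $d$ (a set with at most one element satisfies this vacuously). *)

(* Defs.v *)
From HB Require Import structures.
From mathcomp Require Import all_boot all_order all_algebra.

Set Implicit Arguments.
Unset Strict Implicit.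
Unset Printing Implicit Defensive.

Definition prime_power (q : nat) : Prop :=
  exists p e : nat, [/\ prime p, 0 < e & q = p ^ e].

(* The library gives {vspace V} only a choiceType structure. Over a finite
   field it is a finType, as a subtype of the square matrices of size dim V:
   a subspace is represented by its canonical generating matrix. *)
Section FiniteSubspaces.
Import VectorInternalTheory.
Variables (F : finFieldType) (V : vectType F).
HB.instance Definition _ := [Countable of {vspace V} by <:].
HB.instance Definition _ := [Finite of {vspace V} by <:].
End FiniteSubspaces.

Section SubspaceCodes.
Variables (F : finFieldType) (n : nat).
Implicit Types (U W : {vspace 'rV[F]_n}) (C : {set {vspace 'rV[F]_n}}).

(* The subtraction never truncates, since U :&: W is contained in U + W. *)
Definition subspace_dist U W : nat := \dim (U + W)%VS - \dim (U :&: W)%VS.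

Definition constant_dim_code (d k : nat) C : bool :=
  [forall U in C, \dim U == k] &&
  [forall U in C, forall W in C, (U != W) ==> (d <= subspace_dist U W)].

(* This is a true maximum: set0 always satisfies constant_dim_code d k. *)
Definition max_code_size (d k : nat) : nat :=
  \max_(C : {set {vspace 'rV[F]_n}} | constant_dim_code d k C) #|C|.

End SubspaceCodes.

Arguments max_code_size F n d k : clear implicits.

(* Main.v *)
Require Import Defs.
From HB Require Import structures.
From mathcomp Require Import all_boot all_order all_algebra.
From mathcomp Require Import all_field.
From mathcomp Require Import ring zify.

Set Implicit Arguments.
Unset Strict Implicit.
Unset Printing Implicit Defensive.

Import GRing.Theory.
Local Open Scope ring_scope.

(** Let q = #|F|. The code is obtained from one extension step, applied twice.
    Suppose that E has dimension 4, that X carries N subspaces of dimension 4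
    meeting pairwise in dimension at most 2, and m subspaces of dimension 4
    meeting pairwise in 0. Then X * E carries
<<
       N q^12 + m (q^2 + q + 1) (q^2 + 1)^2 q^2 + 1
>>
    subspaces of dimension 4 meeting pairwise in dimension at most 2
    (code_extension), of three kinds.
    - Lifted codewords: the graphs of g \o h^-1, where h is an isomorphism of E
      onto a codeword of X and g runs through q^12 endomorphisms of E whose
      pairwise differences have a kernel of dimension at most 2. Such a family
      is given by the linearized polynomials a x + b x^q + c x^(q^2) over the
      field with q^4 elements, a nonzero one having at most q^2 roots
      (MRD_code). A lifted codeword meets 0 * E trivially.
    - Coset codewords, which meet 0 * E in a 2-dimensional subspace: such a
      codeword has a line L of E as its intersection with 0 * E, projects onto
      a line M lying in one of the m given subspaces of X, and is determined by
      L, M and a map from M to a complement of L. For every pair (L, M) this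
      map is taken among q^2 maps with injective pairwise differences.
      The lines of a 4-dimensional space are partitioned into q^2 + q + 1
      spreads of q^2 + 1 lines each (parallelism), and L and M are required to
      belong to spreads with the same label. Two distinct admissible pairs
      (L, M) and (L', M') then satisfy dim (L :&: L') + dim (M :&: M') <= 2.
    - The subspace 0 * E itself.

    The step is used with X = E and N = m = 1, and then with X = E * E, whose
    q^4 + 1 lines over the field with q^4 elements form a spread of
    4-dimensional subspaces. Expanding the result gives the stated polynomial.

    The parallelism is built on K * K, with K the quadratic extension of F. One
    of its spreads consists of the K-lines. The other F-lines are of two types:
    those meeting K * 0 in a point, and the graphs over the second factor of
    F-linear maps K -> K that are not K-linear. Fix such a map T. A class is
    labelled by W in K^* modulo F^* and t in K modulo F W; it contains the
    graphs of y |-> x T (W y) + t y + m W y for x in F^* and m in F, together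
    with, for each u in K^* modulo F^*, the line through (u, 0) and
    (t w + tau u, w), where w = u / W. For q > 2 one may take tau = 0
    and T without eigenvalues in F; for q = 2 the only nonzero scalar is 1, and
    a suitable tau makes any T work (twist_exists). *)

(** * Linear maps and dimensions *)

Section LinearAlgebra.
Variables (F : fieldType).

Lemma hom_onto (V W : vectType F) (U : {vspace W}) :
  \dim {:V} = \dim U -> exists2 f : 'Hom(V, W), lker f = 0%VS & limg f = U.
Proof.
move=> dVU.
have [f Df] := linear_of_free (vbasis {:V}) (vbasis U).
have {}Df : map (linfun f) (vbasis {:V}) = vbasis U.
  rewrite -Df ?(basis_free (vbasisP _)) ?size_tuple //.
  by apply: eq_map => x; rewrite lfunE.
have limgf : limg (linfun f) = U.
  by rewrite -(span_basis (vbasisP {:V})) limg_span Df (span_basis (vbasisP U)).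
exists (linfun f) => //; apply/eqP; rewrite -dimv_eq0.
by have := limg_ker_dim (linfun f) {:V}; rewrite limgf capfv dVU => /eqP;
  rewrite -{2}[\dim U]add0n eqn_add2r.
Qed.

Lemma hom_iso (V W : vectType F) : \dim {:V} = \dim {:W} ->
  exists2 f : 'Hom(V, W), lker f = 0%VS & limg f = {:W}%VS.
Proof. by move/hom_onto. Qed.

Lemma hom_onto_family (I : finType) (V W : vectType F) (U : I -> {vspace W}) :
    (forall i, \dim {:V} = \dim (U i)) ->
  exists f : I -> 'Hom(V, W), forall i, lker (f i) = 0%VS /\ limg (f i) = U i.
Proof.
move=> dVU; apply: (@fin_all_exists I (fun=> 'Hom(V, W))
  (fun i f => lker f = 0%VS /\ limg f = U i)) => i.
by have [f kf imf] := hom_onto (dVU i); exists f.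
Qed.

Lemma dim_pair (V W : vectType F) :
  \dim {: (V * W)%type} = (\dim {:V} + \dim {:W})%N.
Proof. by rewrite !dimvf. Qed.

Lemma dim_img_le (V W : vectType F) (f : 'Hom(V, W)) (U : {vspace V})
    (Z : {vspace W}) :
  (f @: U <= Z)%VS -> (\dim U <= \dim Z + \dim (U :&: lker f))%N.
Proof. by move/dimvS => le; rewrite -(limg_ker_dim f U) addnC leq_add2r. Qed.

Lemma dim_cap_lt (V : vectType F) (U W : {vspace V}) d :
  \dim U = d.+1 -> \dim W = d.+1 -> U != W -> (\dim (U :&: W) <= d)%N.
Proof.
move=> dU dW; apply: contraNT; rewrite -ltnNge => lt.
have /eqP UW : (U :&: W == U)%VS by rewrite eqEdim capvSl dU.
by rewrite eqEdim -{1}UW capvSr dU dW leqnn.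
Qed.

(** The map x |-> (f x, g x), first as a function, then in 'Hom. *)
Definition pair_fun (U V W : vectType F) (f : 'Hom(U, V)) (g : 'Hom(U, W)) x :=
  (f x, g x).

Lemma pair_fun_is_linear (U V W : vectType F) (f : 'Hom(U, V)) (g : 'Hom(U, W)) :
  linear (pair_fun f g).
Proof. by move=> a x y; rewrite /pair_fun !linearP. Qed.

HB.instance Definition _ (U V W : vectType F) (f : 'Hom(U, V)) (g : 'Hom(U, W)) :=
  GRing.isLinear.Build F U (V * W)%type _ (pair_fun f g)
    (@pair_fun_is_linear U V W f g).

Definition pair_hom (U V W : vectType F) (f : 'Hom(U, V)) (g : 'Hom(U, W)) :
  'Hom(U, (V * W)%type) := linfun (pair_fun f g).

Lemma pair_homE (U V W : vectType F) (f : 'Hom(U, V)) (g : 'Hom(U, W)) x :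
  pair_hom f g x = (f x, g x).
Proof. by rewrite lfunE. Qed.

End LinearAlgebra.

Lemma ord_embedding (T : finType) n :
  (n <= #|T|)%N -> exists e : 'I_n -> T, injective e.
Proof.
move=> le_n; exists (fun i => enum_val (widen_ord le_n i)) => i j /enum_val_inj.
by move/(congr1 val) => ij; apply: val_inj.
Qed.


(** * Finite extensions of a finite field *)

Section FieldExtension.
Variable F : finFieldType.

Lemma card_finvect (V : vectType F) : #|finvect_type V| = (#|F| ^ \dim {:V})%N.
Proof.
case: V => T cT.
by rewrite -(@card_vspacef F (finvect_type (Vector.Pack cT)) cT) card_vspace.
Qed.

Lemma card_vspace_finvect (V : vectType F) (U : {vspace V}) :
  #|[pred x : finvect_type V | (x : V) \in U]| = (#|F| ^ \dim U)%N.
Proof.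
case: V U => T cT U.
rewrite -(@card_vspace F (finvect_type (Vector.Pack cT)) cT U).
exact: eq_card.
Qed.

Lemma frobenius_hom (L : splittingFieldType F) :
  {f : 'AEnd(L) | forall x, f x = x ^+ #|F|}.
Proof.
have /finField_galois_generator[/= a _ Da] : (1 <= {:L})%VS by apply: sub1v.
exists a => x; rewrite -[LHS]/(a x) Da ?memvf //.
by rewrite dimv1 expn1.
Qed.

(** The extension is the splitting field of X^(q^n) - X: this polynomial is
    separable, since its derivative is -1, and its q^n roots are the fixed
    points of the n-th power of the Frobenius map, hence fill a subfield. *)
Lemma field_ext_deg (n : nat) : (0 < n)%N ->
  exists L : splittingFieldType F, \dim {:L} = n.
Proof.
move=> n_gt0; set q := #|F|; have q_gt1 : (1 < q)%N := finNzRing_gt1 F.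
pose m := (q ^ n)%N.
have m_gt1 : (1 < m)%N by rewrite -(exp1n n) ltn_exp2r.
pose P := 'X^m - 'X.
have szP (R : nzRingType) : size (P R) = m.+1.
  by rewrite size_polyDl size_polyXn // size_polyN size_polyX.
have /FinSplittingFieldFor[/= L] : P F != 0 by rewrite -size_poly_eq0 szP.
rewrite rmorphB rmorphXn /= map_polyX -/(P L) => -[zs DPL defL].
exists L.
have mL0 : m%:R = 0 :> L.
  have [p pr_p pcharF] := finPcharP F.
  rewrite /m /q (card_pprimeChar pcharF) -expnM natrX.
  have -> : p%:R = 0 :> L by apply: pcharf0; rewrite pchar_lalg.
  rewrite expr0n gtn_eqF // muln_gt0 n_gt0 andbT.
  have: (1 < p ^ logn p #|F|)%N by rewrite -(card_pprimeChar pcharF).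
  by case: (logn p #|F|) => //; rewrite expn0.
have Uzs : uniq zs.
  rewrite -separable_prod_XsubC -(eqp_separable DPL) unlock.
  rewrite derivB derivXn derivX -scaler_nat mL0 scale0r sub0r.
  by rewrite -scaleN1r coprimepZr ?coprimep1 ?oppr_eq0 ?oner_eq0.
have [a Da] := frobenius_hom L.
pose fix an i : 'AEnd(L) := if i is i'.+1 then comp_ahom a (an i') else \1%AF.
have Dan i x : an i x = x ^+ (q ^ i).
  elim: i => [|i IHi] /=; first by rewrite id_lfunE.
  by rewrite comp_lfunE IHi Da -exprM -expnSr.
have in_zs : zs =i fixedSpace (an n).
  move=> z; rewrite -root_prod_XsubC -(eqp_root DPL) (sameP fixedSpaceP eqP).
  by rewrite /root !hornerE subr_eq0 Dan.
have full : fixedSpace (an n) = {:L}%VS.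
  apply/eqP; rewrite eqEsubv subvf -defL.
  rewrite -[X in (_ <= X)%VS]subfield_closed agenvS //.
  by rewrite subv_add sub1v; apply/span_subvP=> z; rewrite in_zs.
suffices cardL : #|finvect_type L| = m.
  by have /eqP := card_finvect L; rewrite cardL eqn_exp2l // => /eqP.
pose zs' : seq (finvect_type L) := zs.
have -> : #|finvect_type L| = #|zs'|.
  apply: eq_card => z; rewrite [RHS](in_zs z) full.
  by rewrite [RHS]memvf.
apply: succn_inj; have /card_uniqP -> : uniq zs' by exact: Uzs.
by rewrite -(size_prod_XsubC _ id) -(eqp_size DPL) szP.
Qed.

End FieldExtension.

(** * Rank-metric codes from linearized polynomials *)

Section MRD.
Variable F : finFieldType.
Let q := #|F|.
Let q_gt1 : (1 < q)%N := finNzRing_gt1 F.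

(** The elements of U are roots of a nonzero polynomial of degree at most q^k. *)
Lemma linearized_kernel (L : fieldExtType F) (k : nat) (c : 'I_k.+1 -> L) i0
    (U : {vspace L}) :
  c i0 != 0 -> {in U, forall x, \sum_i c i * x ^+ (q ^ i) = 0} ->
  (\dim U <= k)%N.
Proof.
move=> ci0 U0; pose P : {poly L} := \sum_(i < k.+1) c i *: 'X^(q ^ i).
have nzP : P != 0.
  apply: contra ci0 => /eqP P0; have := coef0 L (q ^ i0); rewrite -P0 coef_sum.
  rewrite (bigD1 i0) //= coefZ coefXn eqxx mulr1 big1 ?addr0 => [->//|i ne_i].
  rewrite coefZ coefXn eqn_exp2l // -val_eqE eq_sym in ne_i *.
  by rewrite (negPf ne_i) mulr0.
have szP : (size P <= (q ^ k).+1)%N.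
  apply: leq_trans (size_sum _ _ _) _; apply/bigmax_leqP => i _.
  apply: leq_trans (size_scale_leq _ _) _.
  by rewrite size_polyXn ltnS leq_pexp2l ?(ltnW q_gt1) // -ltnS.
pose rs : seq (finvect_type L) := enum [pred x : finvect_type L | (x : L) \in U].
have rsU : all (root P : pred L) rs.
  apply/(@allP (finvect_type L)) => x; rewrite mem_enum => Ux.
  rewrite rootE horner_sum; apply/eqP; rewrite -[RHS](U0 x Ux).
  by apply: eq_bigr => i _; rewrite hornerZ hornerXn.
have uniq_rs : uniq rs by exact: enum_uniq.
have := leq_trans (max_poly_roots nzP rsU uniq_rs) szP.
have szrs : @size L rs = (q ^ \dim U)%N.
  by rewrite -card_vspace_finvect cardE.
by rewrite ltnS szrs leq_exp2l.
Qed.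

(** The Gabidulin code: q^(n (k + 1)) linear maps between n-dimensional spaces
    whose pairwise differences have rank at least n - k. *)
Lemma MRD_code (V W : vectType F) (n k : nat) :
    \dim {:V} = n -> \dim {:W} = n -> (0 < n)%N ->
  exists (I : finType) (g : I -> 'Hom(V, W)), #|I| = (q ^ (n * k.+1))%N /\
    forall i j, i != j -> (\dim (lker (g i - g j)%R) <= k)%N.
Proof.
move=> dV dW n_gt0; have [L dL] := field_ext_deg F n_gt0.
have [fV kV _] := @hom_iso F V L (etrans dV (esym dL)).
have [fW kW _] := @hom_iso F L W (etrans dL (esym dW)).
have [a Da] := frobenius_hom L.
pose fix an i : 'End(L) := if i is i'.+1 then (a \o an i')%VF else \1%VF.
have Dan i x : an i x = x ^+ (q ^ i).
  elim: i => [|i IHi] /=; first by rewrite id_lfunE.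
  by rewrite comp_lfunE IHi Da -exprM -expnSr.
pose g (c : {ffun 'I_k.+1 -> finvect_type L}) : 'End(L) :=
  \sum_i (amull (c i : L) \o an i)%VF.
have Dg c x : g c x = \sum_i (c i : L) * x ^+ (q ^ i).
  by rewrite sum_lfunE; apply: eq_bigr => i _; rewrite comp_lfunE lfunE /= Dan.
exists {ffun 'I_k.+1 -> finvect_type L}, (fun c => (fW \o g c \o fV)%VF); split.
  by rewrite card_ffun card_finvect card_ord dL expnM.
move=> c d ne_cd; have [i0 ne_i0] : exists i, c i != d i.
  apply/existsP; apply: contraR ne_cd => /existsPn eq_cd.
  by apply/eqP/ffunP => i; apply/eqP/negPn/eq_cd.
have /lker0P injW : lker fW == 0%VS by rewrite kW.
set f := _ - _; rewrite -(limg_dim_eq (f := fV)) ?kV ?capv0 //.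
apply: (@linearized_kernel L k (fun i => (c i : L) - (d i : L)) i0).
  by rewrite subr_eq0.
move=> y /memv_imgP[x /eqlfunP]; rewrite !comp_lfunE => eq_fx ->.
have {}eq_fx : g c (fV x) = g d (fV x) by exact: injW eq_fx.
apply/eqP; under eq_bigr do rewrite mulrBl.
by rewrite sumrB subr_eq0 -!Dg eq_fx.
Qed.

End MRD.

(** * Coordinates in a quadratic extension *)

Section Quadratic.
Variables (F : fieldType) (K : fieldExtType F) (theta : K).
Hypothesis dK : \dim {:K} = 2%N.
Hypothesis theta_nF : theta \notin 1%VS.

Lemma quad_free : free [:: theta; 1 : K].
Proof. by rewrite free_cons span_seq1 theta_nF seq1_free oner_eq0. Qed.

Lemma quad_indep (a b : F) : a%:A + b *: theta = 0 -> a = 0 /\ b = 0.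
Proof.
move=> ab0; have b0 : b = 0.
  apply: contraNeq theta_nF => nz_b; apply/vlineP; exists (- (b^-1 * a)).
  rewrite scaleNr -scalerA -[_ *: 1](addrK (b *: theta)) ab0 sub0r.
  by rewrite scalerN opprK scalerA mulVf ?scale1r.
split=> //; move/eqP: ab0; rewrite b0 scale0r addr0 scaler_eq0 oner_eq0 orbF.
by move/eqP.
Qed.

Lemma quad_inj (a b a' b' : F) :
  a%:A + b *: theta = a'%:A + b' *: theta -> a = a' /\ b = b'.
Proof.
move/eqP; rewrite -subr_eq0 opprD addrACA -!scalerBl => /eqP/quad_indep[/eqP + /eqP].
by rewrite !subr_eq0 => /eqP-> /eqP->.
Qed.

Lemma quad_decomp (x : K) : exists a b : F, x = a%:A + b *: theta.
Proof.
have : x \in (<[theta]> + <[1]>)%VS.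
  suff -> : (<[theta]> + <[1]>)%VS = {:K}%VS by rewrite memvf.
  rewrite -[<[1]>%VS]span_seq1 -span_cons; apply/eqP.
  by rewrite eqEdim subvf dK (eqP quad_free).
case/memv_addP => _ /vlineP[b ->] [_ /vlineP[a ->] ->].
by exists a, b; rewrite addrC.
Qed.

Lemma quad_hom (A B : K) : exists T : 'End(K), T 1 = A /\ T theta = B.
Proof.
have [f Df] := linear_of_free [:: theta; 1 : K] [:: B; A].
case: (Df quad_free erefl) => fth f1.
by exists (linfun f); rewrite !lfunE.
Qed.

(** Representatives of K^* modulo F^*; None stands for the class of F^*. *)
Definition unit_rep (a : option F) : K := if a is Some a then a%:A + theta else 1.
(** An element spanning a complement of the F-line of unit_rep a. *)
Definition compl_rep (a : option F) : K := if a is Some _ then 1 else theta.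

Lemma unit_rep_neq0 a : unit_rep a != 0.
Proof.
case: a => [a|]; last exact: oner_neq0.
apply/eqP => /= W0; have [] := @quad_indep a 1; rewrite ?scale1r // => _ /eqP.
by rewrite oner_eq0.
Qed.

(** Distinct representatives span distinct F-lines. *)
Lemma unit_rep_indep a b (x y : F) :
  x *: unit_rep a = y *: unit_rep b -> a != b -> x = 0 /\ y = 0.
Proof.
case: a b => [a|] [b|] //=; rewrite ?scalerDr ?scalerA => E ne_ab.
- have [] := quad_inj E => E1 E2; rewrite E2 in E1 *.
  have [->//|nz_y] := eqVneq y 0.
  by rewrite (mulfI nz_y E1) eqxx in ne_ab.
- have [] := @quad_inj (x * a) x y 0; first by rewrite scale0r addr0.
  by move=> + x0; rewrite x0 mul0r => <-.
- have [] := @quad_inj x 0 (y * b) y; first by rewrite scale0r addr0.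
  by move=> + y0; rewrite -y0 mul0r => ->.
Qed.

Lemma compl_rep_indep a (x y : F) : x *: compl_rep a = y *: unit_rep a -> x = 0.
Proof.
case: a => [a|] /=; rewrite ?scalerDr ?scalerA => E.
  have [] := @quad_inj x 0 (y * a) y; first by rewrite scale0r addr0.
  by move=> + y0; rewrite -y0 mul0r.
by have [] := @quad_inj 0 x y 0; first by rewrite !scale0r addr0 add0r.
Qed.

(** The conditions on (T, tau) under which the lines defined below form a
    parallelism: T is not K-linear; two graphs of the same class meet trivially;
    a graph and a line through a point of K * 0 in the same class meet
    trivially. *)
Definition twist (T : 'End(K)) (tau : K -> K) :=
  [/\ forall z, ~ (forall y, T y = z * y),
      forall x x' m : F, x != 0 -> x' != 0 -> x != x' ->
        forall z, (x - x') *: T z = m *: z -> z = 0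
    & forall (x m : F) u, x != 0 -> u != 0 -> x *: T u - tau u <> m *: u].

End Quadratic.

(** For q > 2, T is multiplication by theta conjugated by the shear fixing 1
    and mapping theta to theta + s: it has the characteristic polynomial of
    theta, hence no eigenvalue in F, and it is not K-linear if s differs from 0
    and from the trace t of theta. *)
Lemma twist_exists (F : finFieldType) (K : fieldExtType F) (theta : K) :
  \dim {:K} = 2%N -> theta \notin 1%VS -> exists T tau, @twist F K T tau.
Proof.
move=> dK nFth; have indep := quad_indep nFth; have inj := quad_inj nFth.
have [q2|q_ne2] := eqVneq #|F| 2%N.
  have F2 (x : F) : x != 0 -> x = 1.
    move=> nzx; apply/eqP; apply: contraT => nx1.
    have : (#|x |: [set 0%R; 1%R]| <= #|F|)%N by apply: max_card.
    by rewrite q2 cardsU1 cards2 !inE negb_or nzx nx1 eq_sym oner_eq0.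
  (* Any map that is not K-linear would do; this one is a projection onto F. *)
  have [T [T1 Tth]] := quad_hom nFth 1 0.
  exists T, (fun u => T u + theta * u); split.
  - move=> z Tz; have := Tz 1; rewrite T1 mulr1 => z1.
    have := Tz theta; rewrite Tth -z1 mul1r => th0.
    by rewrite -th0 mem0v in nFth.
  - by move=> x x' m /F2-> /F2->; rewrite eqxx.
  - move=> x m u /F2-> nzu; rewrite scale1r opprD addNKr => E.
    have /negP := nFth; apply; apply/vlineP; exists (- m); apply: (mulIf nzu).
    by rewrite -scalerAl mul1r scaleNr -E opprK.
have q_gt2 : (2 < #|F|)%N by rewrite ltn_neqAle eq_sym q_ne2 finNzRing_gt1.
have [t' [t th2]] := quad_decomp dK nFth (theta * theta).
have [s nz_s ne_st] : exists2 s : F, s != 0 & s != t.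
  have : (0 < #|~: [set 0%R; t]|)%N.
    by rewrite cardsCs setCK subn_gt0 (leq_ltn_trans _ q_gt2) // cards2; case: eqP.
  by case/card_gt0P => s; rewrite !inE negb_or => /andP[]; exists s.
pose A := s%:A + theta.
pose B := ((t - s) * s + t')%:A + (t - s) *: theta.
have [T [T1 Tth]] := quad_hom nFth A B.
have TE a b : T (a%:A + b *: theta)
    = (a * s + b * ((t - s) * s + t'))%:A + (a + b * (t - s)) *: theta.
  rewrite linearD !linearZ /= T1 Tth /A /B !scalerDr !scalerA !scalerDl.
  by rewrite addrACA.
have eig (m : F) z : T z = m *: z -> z = 0.
  have [a [b ->]] := quad_decomp dK nFth z.
  rewrite TE scalerDr !scalerA => /inj[E1 E2].
  have Db : b * (m * m - t * m - t') = 0.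
    have Da : a = m * b - b * (t - s) by rewrite -E2 addrK.
    rewrite Da in E1.
    rewrite -[RHS](subrr (m * (m * b - b * (t - s)))) -{2}E1; ring.
  have b0 : b = 0.
    apply/eqP; case/eqP: Db; rewrite mulf_eq0 => /orP[//|/eqP m_root].
    (* An eigenvalue m would be a root of the minimal polynomial of theta. *)
    have : (theta - m%:A) * (theta - (t - m)%:A) = 0.
      have Dt' : t'%:A = m%:A * m%:A - t%:A * m%:A :> K.
        rewrite -!scalerAl !mul1r !scalerA -scalerBl; congr (_ *: _).
        by apply/eqP; rewrite -subr_eq0 -opprB m_root oppr0.
      transitivity (theta * theta - t%:A * theta - t'%:A).
        by rewrite Dt' scalerBl; ring.
      by rewrite th2 mulr_algl addrK subrr.
    by move/eqP; rewrite mulf_eq0 !subr_eq0 => /orP[]/eqP Dth;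
      rewrite Dth memvZ ?mem1v in nFth.
  have a0 : a = 0 by move: E2; rewrite b0 mul0r addr0 mulr0.
  by rewrite a0 b0 !scale0r addr0.
exists T, (fun=> 0); split.
- move=> z Tz; have := Tz theta; have := Tz 1.
  rewrite T1 Tth mulr1 => <- E.
  have : ((t - s) * s + t')%:A + (t - s) *: theta = t'%:A + (t + s) *: theta.
    by rewrite -[LHS]/B E /A mulrDl mulr_algl th2 scalerDl; ring.
  case/inj => /eqP; rewrite -subr_eq0 addrK mulf_eq0 (negPf nz_s) orbF subr_eq0.
  by rewrite eq_sym (negPf ne_st).
- move=> x x' m _ _ ne_x z E; apply: (@eig ((x - x')^-1 * m)).
  by rewrite -scalerA -E scalerA mulVf ?scale1r // subr_eq0.
- move=> x m u nzx nzu; rewrite subr0 => E; case/eqP: nzu.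
  by apply: (@eig (x^-1 * m)); rewrite -scalerA -E scalerA mulVf ?scale1r.
Qed.

(** * The Desarguesian spread of K * K *)

Section DesarguesianSpread.
Variables (F : finFieldType) (K : fieldExtType F).
Local Notation V := (K * K)%type.

(** The one-dimensional K-subspaces of K * K: those of slope z, given by
    v.1 = z * v.2, and the first factor K * 0. *)
Definition desarguesian_line (z : option (finvect_type K)) : {vspace V} :=
  if z is Some z then limg (pair_hom (amull (z : K)) \1%VF)
  else limg (pair_hom \1%VF (0 : 'End(K))).

Lemma desarguesianP z (v : V) :
  (v \in desarguesian_line z) =
    (if z is Some z then v.1 == (z : K) * v.2 else v.2 == 0).
Proof.
case: z v => [z|] [v1 v2] /=; apply/memv_imgP/eqP => /=.
- by case=> y _; rewrite pair_homE lfunE id_lfunE /= => -[-> ->].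
- by move=> ->; exists v2; rewrite ?memvf // pair_homE lfunE id_lfunE.
- by case=> y _; rewrite pair_homE zero_lfunE => -[].
- by move=> ->; exists v1; rewrite ?memvf // pair_homE zero_lfunE id_lfunE.
Qed.

Lemma pair_eta (v : V) : v.1 = 0 -> v.2 = 0 -> v = 0.
Proof. by case: v => v1 v2 /= -> ->. Qed.

Lemma dim_graph (f : 'End(K)) : \dim (limg (pair_hom f \1%VF) : {vspace V}) = \dim {:K}.
Proof.
rewrite limg_dim_eq //; apply/eqP; rewrite capfv -subv0; apply/subvP => y.
rewrite memv_ker pair_homE id_lfunE memv0 => /eqP[_ ->]; exact: eqxx.
Qed.

Lemma dim_desarguesian z : \dim (desarguesian_line z) = \dim {:K}.
Proof.
case: z => [z|] /=; first exact: dim_graph.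
rewrite limg_dim_eq //; apply/eqP; rewrite capfv -subv0; apply/subvP => y.
rewrite memv_ker pair_homE id_lfunE memv0 => /eqP[-> _]; exact: eqxx.
Qed.

Lemma desarguesian_disjoint z z' v : z != z' ->
  v \in desarguesian_line z -> v \in desarguesian_line z' -> v = 0.
Proof.
rewrite !desarguesianP => ne_z; case: z z' ne_z => [z|] [z'|] //= ne_z.
- move=> /eqP v1 /eqP; rewrite v1 => /eqP; rewrite -subr_eq0 -mulrBl mulf_eq0.
  rewrite subr_eq0 => /orP[/eqP zz'|/eqP v2]; first by rewrite zz' eqxx in ne_z.
  by apply: pair_eta; rewrite ?v1 v2 ?mulr0.
- by move=> /eqP v1 /eqP v2; apply: pair_eta; rewrite ?v1 v2 ?mulr0.
- by move=> /eqP v2 /eqP v1; apply: pair_eta; rewrite ?v1 v2 ?mulr0.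
Qed.

End DesarguesianSpread.

(** * A parallelism of the lines of a 4-dimensional space *)

Section Parallelism.
Variables (F : finFieldType) (K : fieldExtType F) (theta : K).
Hypothesis dK : \dim {:K} = 2%N.
Hypothesis theta_nF : theta \notin 1%VS.
Variables (T : 'End(K)) (tau : K -> K).
Hypothesis twT : twist T tau.

Local Notation W := (unit_rep theta).
Local Notation V := (K * K)%type.
Let q := #|F|.

(** The map y |-> x T (W y) + t y + m W y, where W = unit_rep theta a is the
    first label of the class and t = r *: compl_rep theta a the second. *)
Definition twist_slope (a : option F) (r x m : F) : 'End(K) :=
  (x *: (T \o amull (W a)) + amull (r *: compl_rep theta a + m *: W a))%VF.

(** The lines of class (a, r) that meet K * 0 trivially. *)
Definition skew_line a r x m : {vspace V} :=
  limg (pair_hom (twist_slope a r x m) \1%VF).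

Definition axis_vec (b : option F) : V := (W b, 0).

Definition meet_vec (a : option F) (r : F) (b : option F) : V :=
  (r *: compl_rep theta a * (W b / W a) + tau (W b), W b / W a).

(** The line of class (a, r) through the point of K * 0 spanned by axis_vec b. *)
Definition meet_line (a : option F) (r : F) (b : option F) : {vspace V} :=
  (<[axis_vec b]> + <[meet_vec a r b]>)%VS.

Lemma twist_slopeE a r x m y : twist_slope a r x m y =
  x *: T (W a * y) + r *: compl_rep theta a * y + m *: (W a * y).
Proof.
rewrite add_lfunE scale_lfunE comp_lfunE !lfunE /= mulrDl addrA.
by rewrite -[m *: W a * y]scalerAl.
Qed.

Lemma skewP a r x m (v : V) :
  (v \in skew_line a r x m) = (v.1 == twist_slope a r x m v.2).
Proof.
case: v => v1 v2 /=; apply/memv_imgP/eqP => /=.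
  by case=> y _; rewrite pair_homE id_lfunE => -[-> ->].
by move=> ->; exists v2; rewrite ?memvf // pair_homE id_lfunE.
Qed.

Lemma meetP a r b (v : V) : reflect (exists c d : F,
   v.1 = c *: W b + d *: (r *: compl_rep theta a * (W b / W a) + tau (W b))
   /\ v.2 = d *: (W b / W a)) (v \in meet_line a r b).
Proof.
apply: (iffP memv_addP) => [[_ /vlineP[c ->] [_ /vlineP[d ->] ->]]|[c [d [v1 v2]]]].
  by exists c, d; split=> //=; rewrite scaler0 add0r.
exists (c *: axis_vec b); first by rewrite memvZ ?memv_line.
exists (d *: meet_vec a r b).
  by rewrite memvZ ?memv_line.
by apply/eqP; rewrite -pair_eqE /pair_eq /= v1 v2 scaler0 add0r !eqxx.
Qed.

Let W_neq0 a : W a != 0 := unit_rep_neq0 theta_nF a.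
Let ratio_neq0 a b : W b / W a != 0.
Proof. by rewrite mulf_neq0 ?invr_neq0. Qed.
Let W_ratio a y : W a * (y / W a) = y.
Proof. by rewrite mulrC divfK. Qed.

Let slope_not_scalar a r x m z : x != 0 -> ~ (forall y, twist_slope a r x m y = z * y).
Proof.
move=> nzx E; case: twT => T_not_scalar _ _.
apply: (T_not_scalar (x^-1 *: ((z - r *: compl_rep theta a - m *: W a) / W a))) => y.
have := E (y / W a); rewrite twist_slopeE W_ratio => {}E.
apply: (scalerI nzx); rewrite -!scalerAl scalerA mulfV // scale1r.
have -> : x *: T y = z * (y / W a) - r *: compl_rep theta a * (y / W a) - m *: y.
  by rewrite -E; ring.
have -> : m *: y = m *: W a * (y / W a) by rewrite -scalerAl W_ratio.
by ring.
Qed.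

(** There are q^2 + 1 indices, and so as many lines in each class. *)
Definition line_index : finType := (option F + ({x : F | x != 0} * F))%type.

Definition twisted_line a r (j : line_index) : {vspace V} :=
  match j with
  | inl b => meet_line a r b
  | inr (x, m) => skew_line a r (val x) m
  end.

Lemma dim_twisted a r j : \dim (twisted_line a r j) = 2%N.
Proof.
case: j => [b|[x m]] /=; last by rewrite dim_graph dK.
rewrite dimv_disjoint_sum ?dim_vline.
  rewrite -!pair_eqE /pair_eq /= (negPf (W_neq0 b)).
  by rewrite (negPf (ratio_neq0 a b)) andbF.
apply/eqP; rewrite -subv0; apply/subvP => v /memv_capP[/vlineP[c ->] /vlineP[d E]].
move/(congr1 snd): (E) => /= /eqP.
rewrite scaler0 eq_sym scaler_eq0 (negPf (ratio_neq0 a b)) orbF => /eqP d0.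
by rewrite E d0 scale0r mem0v.
Qed.

(** If the two graphs agree at v.2, then W v.2 is an eigenvector of a multiple
    of T, or is killed by a nonzero scalar. *)
Lemma skew_disjoint a r x m x' m' v : x != 0 -> x' != 0 -> (x, m) != (x', m') ->
  v \in skew_line a r x m -> v \in skew_line a r x' m' -> v = 0.
Proof.
move=> nzx nzx' ne; rewrite !skewP => /eqP v1 /eqP; rewrite v1 !twist_slopeE => E.
suff v2 : v.2 = 0 by apply: pair_eta; rewrite ?v1 v2 ?linear0.
suff : W a * v.2 = 0 by move/eqP; rewrite mulf_eq0 (negPf (W_neq0 a)) => /eqP.
have {}E : (x - x') *: T (W a * v.2) = (m' - m) *: (W a * v.2).
  apply/eqP; rewrite -subr_eq0 !scalerBl; apply/eqP.
  by move/eqP: E; rewrite -subr_eq0 => /eqP <-; ring.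
case: twT => _ T_no_eig _; have [xx'|ne_x] := eqVneq x x'; last exact: T_no_eig E.
move/esym/eqP: E; rewrite xx' subrr scale0r scaler_eq0 subr_eq0.
by case: eqP => [mm'|_ /eqP //]; rewrite xx' mm' eqxx in ne.
Qed.

Lemma meet_skew_disjoint a r b x m v : x != 0 ->
  v \in meet_line a r b -> v \in skew_line a r x m -> v = 0.
Proof.
move=> nzx /meetP[c [d [v1 v2]]]; rewrite skewP v1 v2 twist_slopeE.
rewrite -!scalerAr W_ratio [T _]linearZ /= => /eqP E.
have [d0|nzd] := eqVneq d 0.
  rewrite d0 !scale0r !scaler0 !addr0 in E v1 v2.
  by apply: pair_eta => //; rewrite v1 E.
case: twT => _ _ /(_ x (d^-1 * c - m) (W b) nzx (W_neq0 b)); case.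
apply: (scalerI nzd); rewrite scalerA mulrBr mulrA mulfV // mul1r !scalerBl scalerBr.
rewrite !scalerA [d * x]mulrC [d * m]mulrC in E *.
by apply/eqP; rewrite -subr_eq0 -oppr_eq0; move: E => /eqP; rewrite -subr_eq0 => /eqP<-;
  apply/eqP; rewrite !scalerDr; ring.
Qed.

(** Multiplied by W a, the second coordinates are F-multiples of W b and W b';
    so both vanish, and then so do the first coordinates. *)
Lemma meet_disjoint a r b b' v : b != b' ->
  v \in meet_line a r b -> v \in meet_line a r b' -> v = 0.
Proof.
move=> ne_b /meetP[c [d [v1 v2]]] /meetP[c' [d' []]]; rewrite v1 v2 => E1 E2.
have [d0 d0'] : d = 0 /\ d' = 0.
  apply: (unit_rep_indep theta_nF _ ne_b).
  by move/(congr1 ( *%R (W a))): E2; rewrite -!scalerAr !W_ratio.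
rewrite d0 d0' !scale0r !addr0 in E1 v1 v2.
have [c0 _] := unit_rep_indep theta_nF E1 ne_b.
by apply: pair_eta => //; rewrite v1 c0 scale0r.
Qed.

Lemma twisted_disjoint a r j j' v : j != j' ->
  v \in twisted_line a r j -> v \in twisted_line a r j' -> v = 0.
Proof.
case: j j' => [b|[[x nzx] m]] [b'|[[x' nzx'] m']] //= ne_j.
- exact: meet_disjoint.
- exact: meet_skew_disjoint.
- by move=> vs vm; apply: (meet_skew_disjoint nzx vm vs).
- exact: skew_disjoint.
Qed.

Lemma mem_axis_vec a r b : axis_vec b \in meet_line a r b.
Proof. by apply: (subvP (addvSl _ _)); rewrite memv_line. Qed.

Lemma mem_meet_vec a r b : meet_vec a r b \in meet_line a r b.
Proof. by apply: (subvP (addvSr _ _)); rewrite memv_line. Qed.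

Lemma mem_graph_vec a r x m y :
  ((twist_slope a r x m y, y) : V) \in skew_line a r x m.
Proof. by rewrite skewP. Qed.

(** K-lines other than K * 0 are graphs of multiplications and meet K * 0
    trivially. *)
Lemma desarguesian_twisted z a r j : desarguesian_line z != twisted_line a r j.
Proof.
apply/eqP => E; case: j E => [b|[[x nzx] m]] /= E.
  case: z E => [z|] E.
    have := mem_axis_vec a r b; rewrite -E desarguesianP /= mulr0.
    by rewrite (negPf (W_neq0 b)).
  have := mem_meet_vec a r b.
  by rewrite -E desarguesianP /= (negPf (ratio_neq0 a b)).
have S y := mem_graph_vec a r x m y; rewrite -E in S.
case: z S {E} => [z|] S; last by have := S 1; rewrite desarguesianP /= oner_eq0.
apply: (@slope_not_scalar a r x m (z : K) nzx) => y.
by have := S y; rewrite desarguesianP /= => /eqP.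
Qed.

Lemma meet_line_inj a r b a' r' b' :
  meet_line a r b = meet_line a' r' b' -> (a, r) = (a', r').
Proof.
move=> E; have := mem_axis_vec a r b; rewrite E.
case/meetP=> c1 [d1 [/= E1 /esym/eqP]].
rewrite scaler_eq0 (negPf (ratio_neq0 _ _)) orbF => /eqP d1_0.
rewrite d1_0 scale0r addr0 in E1.
have bb' : b = b'.
  apply/eqP; apply: contraT => ne_b.
  have [/eqP] := unit_rep_indep theta_nF (etrans (scale1r _) E1) ne_b.
  by rewrite oner_eq0.
subst b'; have := mem_meet_vec a r b; rewrite E => /meetP[c2 [d2 [/= E2 E3]]].
have {}E3 : 1 *: W a' = d2 *: W a.
  apply: (mulIf (W_neq0 b)); rewrite scale1r.
  have /(congr1 (fun y => W a' * (W a * y))) := E3.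
  by rewrite /= W_ratio -!scalerAr mulrCA W_ratio => ->; rewrite scalerAl.
have aa' : a' = a.
  apply/eqP; apply: contraT => ne_a.
  by have [/eqP] := unit_rep_indep theta_nF E3 ne_a; rewrite oner_eq0.
subst a'; have d2_1 : d2 = 1.
  apply/eqP; rewrite -subr_eq0; apply: contraT => /(scalerI)/(_ (W a) 0).
  by rewrite scaler0 scalerBl -E3 subrr => /(_ erefl)/eqP; rewrite (negPf (W_neq0 a)).
congr (_, _); apply/eqP; rewrite -subr_eq0; apply/eqP.
apply: (@compl_rep_indep _ _ _ theta_nF a _ c2).
apply: (mulIf (ratio_neq0 a b)); rewrite -[c2 *: _ * _]scalerAl W_ratio.
move: E2; rewrite d2_1 scale1r addrA => /addIr E2.
by rewrite scalerBl mulrBl E2 addrK.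
Qed.

(** If x W a differs from x' W a', equality of the two slopes makes T a
    multiplication. *)
Lemma skew_line_inj a r x m a' r' x' m' : x != 0 -> x' != 0 ->
  skew_line a r x m = skew_line a' r' x' m' -> (a, r) = (a', r').
Proof.
move=> nzx nzx' E.
have S y : twist_slope a r x m y = twist_slope a' r' x' m' y.
  by apply/eqP; have := mem_graph_vec a r x m y; rewrite E skewP.
pose u := x *: W a - x' *: W a'; have [u0|nz_u] := eqVneq u 0; last first.
  pose z := r' *: compl_rep theta a' + m' *: W a' - r *: compl_rep theta a - m *: W a.
  case: twT => T_not_scalar _ _.
  case: (T_not_scalar (z / u)) => y.
  have [y' ->] : exists y', y = u * y' by exists (y / u); rewrite mulrC divfK.
  rewrite mulrA divfK // /u mulrBl -!scalerAl linearB !linearZ /=.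
  have /eqP := S y'; rewrite !twist_slopeE -subr_eq0 => /eqP E0.
  apply/eqP; rewrite -subr_eq0 -E0 /z !mulrBl mulrDl -!scalerAl; apply/eqP; ring.
move/eqP: u0; rewrite subr_eq0 => /eqP u0.
have aa' : a = a'.
  apply/eqP; apply: contraT => ne_a.
  by have [x0 _] := unit_rep_indep theta_nF u0 ne_a; rewrite x0 eqxx in nzx.
subst a'; have xx' : x = x'.
  apply/eqP; rewrite -subr_eq0; apply: contraT => /(scalerI)/(_ (W a) 0).
  by rewrite scaler0 scalerBl u0 subrr => /(_ erefl)/eqP; rewrite (negPf (W_neq0 a)).
subst x'; congr (_, _); apply/eqP; rewrite -subr_eq0; apply/eqP.
apply: (@compl_rep_indep _ _ _ theta_nF a _ (m' - m)).
have /eqP := S 1; rewrite !twist_slopeE !mulr1 -subr_eq0 => /eqP E0.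
by apply/eqP; rewrite -subr_eq0 -E0 !scalerBl; apply/eqP; ring.
Qed.

Lemma twisted_inj a r j a' r' j' :
  twisted_line a r j = twisted_line a' r' j' -> (a, r) = (a', r').
Proof.
case: j j' => [b|[[x nzx] m]] [b'|[[x' nzx'] m']] /=.
- exact: meet_line_inj.
- move=> E; have := mem_axis_vec a r b; rewrite E skewP /= linear0.
  by rewrite (negPf (W_neq0 b)).
- move=> E; have := mem_axis_vec a' r' b'; rewrite -E skewP /= linear0.
  by rewrite (negPf (W_neq0 b')).
- exact: skew_line_inj.
Qed.

End Parallelism.

(** As there are (q^2 + q + 1) (q^2 + 1) lines in all, the classes L i are
    spreads that partition the set of all lines; only the disjointness
    properties below are needed. *)
Lemma parallelism (F : finFieldType) (V : vectType F) (q := #|F|) :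
    \dim {:V} = 4 ->
  exists L : 'I_(q ^ 2 + q + 1) -> 'I_(q ^ 2 + 1) -> {vspace V},
  [/\ forall i j, \dim (L i j) = 2%N,
      forall i j j', j != j' -> (L i j :&: L i j' = 0)%VS
    & forall i i' j j', i != i' -> L i j != L i' j'].
Proof.
move=> dV; have [K dK] := field_ext_deg F (isT : (0 < 2)%N).
have [theta nFth] : exists theta : K, theta \notin 1%VS.
  have : ~~ ({:K} <= 1)%VS.
    by apply/negP => /dimvS; rewrite dK dimv1.
  by case/subvPn => theta _; exists theta.
have [T [tau twT]] := twist_exists dK nFth.
have cF0 : #|{: {x : F | x != 0}}| = q.-1.
  by rewrite card_sig -(cardC1 (0 : F)); apply: eq_card => x; rewrite !inE.
have [eI injI] : exists e : 'I_(q ^ 2 + q + 1) -> option (option F * F), injective e.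
  by apply: ord_embedding; rewrite card_option card_prod card_option -/q; lia.
have [eJ injJ] : exists e : 'I_(q ^ 2 + 1) -> line_index F, injective e.
  apply: ord_embedding; rewrite /line_index card_sum card_prod card_option cF0 -/q.
  have : (0 < q)%N := ltnW (finNzRing_gt1 F).
  by rewrite -/q; move: (q) => [|n] //= _; lia.
have [eZ injZ] : exists e : 'I_(q ^ 2 + 1) -> option (finvect_type K), injective e.
  by apply: ord_embedding; rewrite card_option card_finvect dK -/q; lia.
have [h kh _] : exists2 h : 'Hom((K * K)%type, V), lker h = 0%VS & limg h = fullv.
  by apply: hom_iso; rewrite dim_pair dK dV.
have {}kh : lker h == 0%VS by rewrite kh.
(* The class None of eI is the Desarguesian spread. *)
pose L0 i j := if eI i is Some (a, r) then twisted_line theta T tau a r (eJ j)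
               else desarguesian_line (eZ j).
exists (fun i j => (h @: L0 i j)%VS); split.
- move=> i j; rewrite limg_dim_eq; last by rewrite (eqP kh) capv0.
  rewrite /L0; case: (eI i) => [[a r]|].
    by rewrite (dim_twisted dK nFth).
  by rewrite dim_desarguesian.
- move=> i j j' ne_j; rewrite -lker0_img_cap //; apply/eqP.
  rewrite -[0%VS](limg0 h) (eq_limg_ker0 _ _ kh) -subv0; apply/subvP => v.
  case/memv_capP; rewrite /L0 memv0; case: (eI i) => [[a r]|] v1 v2; apply/eqP.
    by apply: (twisted_disjoint nFth twT _ v1 v2); rewrite (inj_eq injJ).
  by apply: (desarguesian_disjoint _ v1 v2); rewrite (inj_eq injZ).
- move=> i i' j j'; apply: contraNneq => /eqP; rewrite (eq_limg_ker0 _ _ kh).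
  rewrite -(inj_eq injI) /L0; case: (eI i) (eI i') => [[a r]|] [[a' r']|] //.
  + by move=> /eqP/(twisted_inj nFth twT) ->.
  + by rewrite eq_sym (negPf (desarguesian_twisted nFth twT _ _ _ _)).
  + by rewrite (negPf (desarguesian_twisted nFth twT _ _ _ _)).
Qed.

(** * Subspaces of a product X * E *)

Section Extension.
Variables (F : fieldType) (X E : vectType F).
Local Notation V := (X * E)%type.

Definition fst_hom : 'Hom(V, X) := linfun fst.

Lemma fst_homE v : fst_hom v = v.1.
Proof. by rewrite lfunE. Qed.

(** The subspace 0 * L. *)
Definition vert (L : {vspace E}) : {vspace V} := (pair_hom 0 \1%VF @: L)%VS.

Lemma vertP L (v : V) : (v \in vert L) = (v.1 == 0) && (v.2 \in L).
Proof.
apply/memv_imgP/andP => [[y Ly ->]|]; first by rewrite pair_homE zero_lfunE id_lfunE.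
case: v => v1 v2 /= [/eqP-> Lv2]; exists v2 => //.
by rewrite pair_homE zero_lfunE id_lfunE.
Qed.

Lemma dim_vert L : \dim (vert L) = \dim L.
Proof.
rewrite limg_dim_eq //; apply/eqP; rewrite -subv0; apply/subvP => y /memv_capP[_].
by rewrite memv_ker pair_homE id_lfunE memv0 => /eqP[_ ->].
Qed.

(** The image of U under the first projection lies in M, the kernel in 0 * L. *)
Lemma dim_fibration (U : {vspace V}) (M : {vspace X}) (L : {vspace E}) :
    {in U, forall v, v.1 \in M} -> {in U, forall v, v.1 = 0 -> v.2 \in L} ->
  (\dim U <= \dim M + \dim L)%N.
Proof.
move=> UM UL; apply: leq_trans (dim_img_le (f := fst_hom) (Z := M) _) _.
  by apply/subvP => _ /memv_imgP[v Uv ->]; rewrite fst_homE UM.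
rewrite leq_add2l -dim_vert dimvS //; apply/subvP => v /memv_capP[Uv].
rewrite memv_ker fst_homE => v1; rewrite vertP v1 /=.
by apply: UL => //; apply/eqP.
Qed.

Section Lift.
Variables (A : vectType F).
Implicit Types (h : 'Hom(A, X)) (g : 'Hom(A, E)) (L : {vspace E}).

(** The image of x |-> (h x, g x): for injective h, the graph over the image of
    h of the map g \o h^-1. *)
Definition graph h g : {vspace V} := limg (pair_hom h g).

Lemma graphP h g v : reflect (exists x, v = (h x, g x)) (v \in graph h g).
Proof.
apply: (iffP (memv_imgP)) => [[x _ ->]|[x ->]]; exists x; rewrite ?memvf //.
  by rewrite pair_homE.
by rewrite pair_homE.
Qed.

Lemma dim_graph_hom h g : lker h = 0%VS -> \dim (graph h g) = \dim {:A}.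
Proof.
move=> kh; rewrite limg_dim_eq //; apply/eqP; rewrite -subv0 -kh capfv.
by apply/subvP => x; rewrite !memv_ker pair_homE => /eqP[->].
Qed.

Lemma graph_vert h g v : lker h = 0%VS -> v \in graph h g -> v.1 = 0 -> v = 0.
Proof.
move=> kh /graphP[x ->] /= /eqP; rewrite -memv_ker kh memv0 => /eqP ->.
by rewrite !linear0.
Qed.

Lemma dim_graph_cap_diff h g h' g' : lker h = 0%VS ->
  (\dim (graph h g :&: graph h' g') <= \dim (limg h :&: limg h'))%N.
Proof.
move=> kh; have <- : (\dim (limg h :&: limg h') + \dim (0 : {vspace E})
    = \dim (limg h :&: limg h'))%N.
  by rewrite dimv0 addn0.
apply: dim_fibration.
  move=> v /memv_capP[/graphP[x ->] /graphP[y [/= hx _]]].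
  by rewrite memv_cap {2}hx !memv_img ?memvf.
by move=> v /memv_capP[/(graph_vert kh) v0 _] /v0->; rewrite mem0v.
Qed.

Lemma dim_graph_cap_same h g g' : lker h = 0%VS ->
  (\dim (graph h g :&: graph h g') <= \dim (lker (g - g')%R))%N.
Proof.
move=> kh; apply: (@leq_trans (\dim (pair_hom h g @: lker (g - g')%R)%VS)).
  apply/dimvS/subvP => v /memv_capP[/graphP[x ->] /graphP[y [/= hx gx]]].
  have /lker0P injh : lker h == 0%VS by rewrite kh.
  rewrite -pair_homE memv_img //; apply/eqlfunP.
  by rewrite gx (injh _ _ hx).
by rewrite -(limg_ker_dim (pair_hom h g) (lker _)) leq_addl.
Qed.

(** For injective h, the subspace whose projection to X is the image of h, whose
    intersection with 0 * E is 0 * L, and which contains the graph of (h, g). *)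
Definition coset_space h g (L : {vspace E}) := (graph h g + vert L)%VS.

Lemma cosetP h g L v :
  reflect (exists x, v.1 = h x /\ v.2 - g x \in L) (v \in coset_space h g L).
Proof.
apply: (iffP memv_addP) => [[_ /graphP[x ->] [w]]|[x [v1 v2]]].
  rewrite vertP => /andP[/eqP w1 Lw ->]; exists x => /=.
  by rewrite w1 addr0 addrC addKr.
exists (h x, g x); first by apply/graphP; exists x.
exists (0, v.2 - g x); first by rewrite vertP eqxx.
case: v v1 {v2} => /= v1 v2 ->; apply/eqP.
by rewrite -pair_eqE /pair_eq /= addr0 addrC subrK !eqxx.
Qed.

Lemma coset_vert h g L v : lker h = 0%VS ->
  v \in coset_space h g L -> v.1 = 0 -> v.2 \in L.
Proof.
move=> kh /cosetP[x [-> +]] /eqP; rewrite -memv_ker kh memv0 => + /eqP x0.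
by rewrite x0 linear0 subr0.
Qed.

Lemma dim_coset h g L : lker h = 0%VS ->
  \dim (coset_space h g L) = (\dim {:A} + \dim L)%N.
Proof.
move=> kh; rewrite dimv_disjoint_sum ?dim_graph_hom ?dim_vert //.
apply/eqP; rewrite -subv0; apply/subvP => v /memv_capP[/(graph_vert kh) v0].
by rewrite vertP memv0 => /andP[/eqP/v0->].
Qed.

Lemma dim_coset_cap h g L h' g' L' : lker h = 0%VS -> lker h' = 0%VS ->
  (\dim (coset_space h g L :&: coset_space h' g' L')
    <= \dim (limg h :&: limg h') + \dim (L :&: L'))%N.
Proof.
move=> kh kh'; apply: dim_fibration => v /memv_capP[].
  move=> /cosetP[x [hx _]] /cosetP[y [hy _]].
  by rewrite memv_cap {1}hx hy !memv_img ?memvf.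
by move=> cv c'v v1; rewrite memv_cap !(coset_vert _ cv) ?(coset_vert _ c'v).
Qed.

(** A common vector lies in 0 * L: since g and g' take their values in a
    complement of L, they agree at its parameter, which must then be 0. *)
Lemma dim_coset_cap_same h g g' L (L' : {vspace E}) : lker h = 0%VS ->
    (L :&: L' = 0)%VS -> (limg g <= L')%VS -> (limg g' <= L')%VS ->
    lker (g - g') = 0%VS ->
  (\dim (coset_space h g L :&: coset_space h g' L) <= \dim L)%N.
Proof.
move=> kh LL' gL' g'L' kg.
have <- : (\dim (0 : {vspace X}) + \dim L = \dim L)%N by rewrite dimv0.
apply: dim_fibration => v /memv_capP[]; last by move=> cv _; apply: coset_vert cv.
move=> /cosetP[x [hx gx]] /cosetP[y [hy gy]].
have /lker0P injh : lker h == 0%VS by rewrite kh.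
have xy : x = y by apply: injh; rewrite -hx hy.
subst y; suff /eqP x0 : x == 0 by rewrite hx x0 linear0 mem0v.
rewrite -memv0 -kg memv_ker add_lfunE opp_lfunE -memv0 -LL' memv_cap; apply/andP; split.
  by have := rpredB gy gx; rewrite opprB addrC addrA subrK.
apply: rpredB; first by apply: (subvP gL'); rewrite memv_img ?memvf.
by apply: (subvP g'L'); rewrite memv_img ?memvf.
Qed.

End Lift.

(** The intersection meets 0 * L trivially inside a space of dimension
    dim B + dim L. *)
Lemma dim_graph_coset_cap (A B : vectType F) (h : 'Hom(A, X)) g (m : 'Hom(B, X)) f
    (L : {vspace E}) :
    lker h = 0%VS -> lker m = 0%VS ->
  (\dim (graph h g :&: coset_space m f L) <= \dim {:B})%N.
Proof.
move=> kh km; rewrite -(leq_add2r (\dim L)) -(dim_coset f L km) -dim_vert.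
rewrite -dimv_disjoint_sum ?dimvS ?subv_add ?capvSr ?addvSr //.
apply/eqP; rewrite -subv0; apply/subvP => v /memv_capP[/memv_capP[/(graph_vert kh) v0 _]].
by rewrite vertP memv0 => /andP[/eqP/v0->].
Qed.

Lemma dim_graph_vert_cap (A : vectType F) (h : 'Hom(A, X)) g
    (L : {vspace E}) :
  lker h = 0%VS -> (graph h g :&: vert L = 0)%VS.
Proof.
move=> kh; apply/eqP; rewrite -subv0; apply/subvP => v /memv_capP[/(graph_vert kh) v0].
by rewrite vertP memv0 => /andP[/eqP/v0->].
Qed.

Lemma dim_coset_vert_cap (A : vectType F) (h : 'Hom(A, X)) g
    (L : {vspace E}) :
  lker h = 0%VS -> (\dim (coset_space h g L :&: vert fullv) <= \dim L)%N.
Proof.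
move=> kh; rewrite -dim_vert; apply/dimvS/subvP => v /memv_capP[cv].
by rewrite !vertP memvf andbT => v1; rewrite v1 (coset_vert _ cv) //; apply/eqP.
Qed.

End Extension.

(** * The extension step and the code *)

Section Codes.
Variable F : finFieldType.
Let q := #|F|.

(** V carries N subspaces of dimension 4 that meet pairwise in dimension at most
    2, that is, at subspace distance at least 4. Distinct indices give distinct
    subspaces, so that the index type counts them. *)
Definition code_of_size (V : vectType F) (N : nat) :=
  exists (I : finType) (c : I -> {vspace V}),
    [/\ #|I| = N, forall i, \dim (c i) = 4%N
      & forall i j, i != j -> (\dim (c i :&: c j) <= 2)%N].

(** V carries m subspaces of dimension 4 with trivial pairwise intersections. *)
Definition partial_spread (V : vectType F) (m : nat) :=
  exists s : 'I_m -> {vspace V},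
    (forall j, \dim (s j) = 4%N) /\ (forall j j', j != j' -> s j :&: s j' = 0)%VS.

(** The index type of the new code is the disjoint union of those of the lifted
    codewords (C1), of the coset codewords (C2) and of a single point for
    0 * E. *)
Lemma code_extension (X E : vectType F) (N m : nat) :
    \dim {:E} = 4%N -> code_of_size X N -> partial_spread X m ->
  code_of_size (X * E)%type
    (N * q ^ 12 + m * (q ^ 2 + q + 1) * (q ^ 2 + 1) ^ 2 * q ^ 2 + 1).
Proof.
move=> dE [I [c [cardI dc cap_c]]] [s [ds cap_s]].
have [J [g [cardJ rank_g]]] := MRD_code 2 dE dE isT.
pose D : vectType F := 'rV[F]_2.
have dD : \dim {:D} = 2%N by rewrite dimvf /= dim_matrix.
have [T [t [cardT rank_t]]] := MRD_code 0 dD dD isT.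
have [L [dL cap_L neq_L]] := parallelism dE.
set na := (_ + 1)%N in L dL cap_L neq_L; set nb := (_ + 1)%N in L dL cap_L neq_L.
have [h Hh] := @hom_onto_family F I E X c (fun i => etrans dE (esym (dc i))).
have [p Hp] := @hom_onto_family F _ E X s (fun j => etrans dE (esym (ds j))).
have dDL (x : 'I_na * 'I_nb) : \dim {:D} = \dim (L x.1 x.2) by rewrite dD dL.
have [l Hl] := hom_onto_family dDL.
have dDC (x : 'I_na * 'I_nb) : \dim {:D} = \dim (L x.1 x.2)^C.
  by rewrite dD dimv_compl dE dL.
have [l' Hl'] := hom_onto_family dDC.
(* l x parametrizes the line of index x, and l' x a complement of it. *)
pose C1 (x : I * J) := graph (h x.1) (g x.2).
pose M j a k := (p j \o l (a, k))%VF.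
pose Q := ('I_m * 'I_na * ('I_nb * 'I_nb) * T)%type.
(* In (j, a, (k, k'), u): j selects a subspace of the partial spread of X, a the
   common class, k the line L of E, k' the line M, and u the map to a
   complement of L. *)
pose C2 (x : Q) := let: (j, a, (k, k'), u) := x in
  coset_space (M j a k') (l' (a, k) \o t u)%VF (L a k).
have kh i : lker (h i) = 0%VS by have [] := Hh i.
have kM j a k : lker (M j a k) = 0%VS.
  apply/eqP/lker0P => x y; rewrite !comp_lfunE.
  have [/eqP/lker0P inj_p _] := Hp j; have [/eqP/lker0P inj_l _] := Hl (a, k).
  by move/inj_p/inj_l.
have imM j a k : limg (M j a k) = (p j @: L a k)%VS.
  by rewrite limg_comp; have [_ ->] := Hl (a, k).
have capM j a k a' k' :
    \dim (limg (M j a k) :&: limg (M j a' k')) = \dim (L a k :&: L a' k').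
  have [/eqP kp _] := Hp j.
  by rewrite !imM -lker0_img_cap // limg_dim_eq // (eqP kp) capv0.
have capM0 j j' a k a' k' : j != j' ->
    \dim (limg (M j a k) :&: limg (M j' a' k')) = 0%N.
  move=> ne_j; apply/eqP; rewrite dimv_eq0 -subv0 -(cap_s _ _ ne_j).
  have [_ <-] := Hp j; have [_ <-] := Hp j'.
  by rewrite !imM capvS // limgS ?subvf.
have dC1 x : \dim (C1 x) = 4%N by rewrite dim_graph_hom.
have dC2 x : \dim (C2 x) = 4%N.
  by case: x => [[[j a] [k k']] u]; rewrite dim_coset // dD dL.
have cap11 x y : x != y -> (\dim (C1 x :&: C1 y) <= 2)%N.
  case: x y => [i j] [i' j']; have [<-|ne_i _] := eqVneq i i'.
    rewrite xpair_eqE eqxx /= => ne_j.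
    by apply: leq_trans (dim_graph_cap_same _ _ (kh i)) (rank_g _ _ ne_j).
  apply: leq_trans (dim_graph_cap_diff _ _ _ (kh i)) _ => /=.
  by have [_ ->] := Hh i; have [_ ->] := Hh i'; apply: cap_c.
have capLM x y z w : (\dim (L x y :&: L z w) <= 2)%N.
  by rewrite -(dL x y) dimvS ?capvSl.
have capL1 x y z w : x != z -> (\dim (L x y :&: L z w) <= 1)%N.
  by move=> ne_x; apply: dim_cap_lt; rewrite ?dL ?neq_L.
have cap22 x y : x != y -> (\dim (C2 x :&: C2 y) <= 2)%N.
  case: x y => [[[j a] [k k']] u] [[[j1 a1] [k1 k1']] u1] ne.
  have bound := dim_coset_cap (l' (a, k) \o t u)%VF (L a k)
    (l' (a1, k1) \o t u1)%VF (L a1 k1) (kM j a k') (kM j1 a1 k1').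
  have [jj|ne_j] := eqVneq j j1; last first.
    by apply: leq_trans bound _; rewrite capM0 // add0n capLM.
  subst j1; have [aa|ne_a] := eqVneq a a1; last first.
    by apply: leq_trans bound _; rewrite capM (@leq_add _ _ 1 1) ?capL1.
  subst a1; have [kk|ne_k] := eqVneq k k1; last first.
    by apply: leq_trans bound _; rewrite capM (cap_L a k k1) // dimv0 addn0 capLM.
  subst k1; have [kk|ne_k] := eqVneq k' k1'; last first.
    by apply: leq_trans bound _; rewrite capM (cap_L a k' k1') // dimv0 add0n capLM.
  subst k1'; have ne_u : u != u1 by apply: contraNneq ne => ->.
  rewrite -(dL a k).
  have im_l' v : (limg (l' (a, k) \o t v) <= (L a k)^C)%VS.
    by have [_ <-] := Hl' (a, k); rewrite limg_comp limgS ?subvf.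
  apply: (dim_coset_cap_same (kM j a k') (capv_compl _) (im_l' u) (im_l' u1)).
  have [kl' _] := Hl' (a, k); apply/eqP; rewrite -subv0; apply/subvP => x.
  rewrite -comp_lfunNr -comp_lfunDr memv_ker comp_lfunE -memv_ker kl' memv0 -memv_ker.
  have : (\dim (lker (t u - t u1)%R) <= 0)%N by apply: rank_t.
  by rewrite leqn0 dimv_eq0 => /eqP->.
pose C (x : I * J + Q + unit) : {vspace (X * E)%type} :=
  match x with
  | inl (inl y) => C1 y
  | inl (inr y) => C2 y
  | inr _ => vert X fullv
  end.
have cap12 x y : (\dim (C1 x :&: C2 y) <= 2)%N.
  case: y => [[[j a] [k k']] u].
  by rewrite -dD dim_graph_coset_cap.
have cap13 x : (\dim (C1 x :&: vert X fullv) <= 2)%N.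
  by rewrite dim_graph_vert_cap // dimv0.
have cap23 x : (\dim (C2 x :&: vert X fullv) <= 2)%N.
  case: x => [[[j a] [k k']] u].
  by rewrite -(dL a k) dim_coset_vert_cap.
exists (I * J + Q + unit)%type, C; split.
- rewrite !card_sum !card_prod card_unit !card_ord cardI cardJ cardT.
  by rewrite /na /nb; lia.
- by case=> [[x|x]|[]] /=; rewrite ?dim_vert.
- move=> [[x|x]|[]] [[y|y]|[]] //= ne; rewrite 1?capvC //.
  + by apply: cap11; rewrite eq_sym.
  + by apply: cap22; rewrite eq_sym.
Qed.

Lemma trivial_code (E : vectType F) : \dim {:E} = 4%N -> code_of_size E 1.
Proof.
move=> dE; exists unit, (fun=> fullv); split=> [|//|[] []//]; exact: card_unit.
Qed.

Lemma trivial_spread (E : vectType F) : \dim {:E} = 4%N -> partial_spread E 1.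
Proof. by move=> dE; exists (fun=> fullv); split=> // j j'; rewrite !ord1. Qed.

Lemma desarguesian_spread (E : fieldExtType F) : \dim {:E} = 4%N ->
  partial_spread (E * E)%type (q ^ 4 + 1).
Proof.
move=> dE.
have [e inj_e] : exists e : 'I_(q ^ 4 + 1) -> option (finvect_type E), injective e.
  by apply: ord_embedding; rewrite card_option card_finvect dE -/q; lia.
exists (fun j => desarguesian_line (e j)); split.
  by move=> j; rewrite dim_desarguesian.
move=> j j' ne_j; apply/eqP; rewrite -subv0; apply/subvP => v /memv_capP[v1 v2].
by rewrite memv0; apply/eqP/(desarguesian_disjoint _ v1 v2); rewrite (inj_eq inj_e).
Qed.

Lemma code_of_size_max (V : vectType F) (n N : nat) :
  \dim {:V} = n -> code_of_size V N -> (N <= max_code_size F n 4 4)%N.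
Proof.
move=> dV [I [c [<- dc cap_c]]].
have dr : \dim {:'rV[F]_n} = n by rewrite dimvf; apply: mul1n.
have [f kf _] := @hom_iso F V 'rV[F]_n (etrans dV (esym dr)).
have {}kf : lker f == 0%VS by rewrite kf.
have dim_f U : \dim (f @: U) = \dim U.
  by rewrite limg_dim_eq // (eqP kf) capv0.
pose d i := (f @: c i)%VS.
have cap_d i j : \dim (d i :&: d j) = \dim (c i :&: c j).
  by rewrite -lker0_img_cap.
have inj_d : injective d.
  move=> i j dij; apply/eqP; apply: contraT => /cap_c.
  by rewrite -cap_d dij capvv dim_f dc.
have -> : #|I| = #|[set d i | i : I]| by rewrite card_imset.
have code : constant_dim_code 4 4 [set d i | i : I].
  apply/andP; split; first by apply/forall_inP => _ /imsetP[i _ ->]; rewrite dim_f dc.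
  apply/forall_inP => _ /imsetP[i _ ->]; apply/forall_inP => _ /imsetP[j _ ->].
  apply/implyP => ne_ij; rewrite /subspace_dist.
  have := dimv_sum_cap (d i) (d j).
  have := cap_c i j; rewrite -cap_d !dim_f !dc.
  have -> : i != j by apply: contraNneq ne_ij => ->.
  by move=> /(_ isT); lia.
exact: (leq_bigmax_cond _ code).
Qed.

End Codes.

Local Close Scope ring_scope.

(* max_code_size F 12 4 4 is A_q(12,4;4), computed in F^12 for an arbitrary
   field F with q elements. *)
Theorem theorem5p4 (q : nat) (hq : prime_power q)
    (F : finFieldType) (hF : #|F| = q) :
  q ^ 24 + q ^ 20 + q ^ 19 + 3 * q ^ 18 + 2 * q ^ 17 + 3 * q ^ 16 + q ^ 15
    + q ^ 14 + 2 * q ^ 12 + q ^ 11 + 3 * q ^ 10 + 2 * q ^ 9 + 4 * q ^ 8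
    + 2 * q ^ 7 + 4 * q ^ 6 + 2 * q ^ 5 + 3 * q ^ 4 + q ^ 3 + q ^ 2 + 1
  <= max_code_size F 12 4 4.
Proof.
have [E dE] := field_ext_deg F (isT : (0 < 4)%N).
have d8 : \dim {: (E * E)%type} = 8%N by rewrite dim_pair dE.
have d12 : \dim {: (E * E * E)%type} = 12%N by rewrite dim_pair d8 dE.
have code8 := code_extension dE (trivial_code dE) (trivial_spread dE).
have code12 := code_extension dE code8 (desarguesian_spread dE).
apply: leq_trans (code_of_size_max d12 code12).
rewrite hF; apply: eq_leq; ring.
Qed.
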